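(* Let $G$ be a finite group. Then $G$ is nilpotent if and only if the set of vertex degrees of the non-nilpotent graph $\mathcal{N}_G$ has at most two elements.
   Context: For a group $G$, the non-nilpotent graph $\mathcal{N}_G$ is the simple graph whose vertex set is $G$, in which two distinct vertices $x,y$ are adjacent if and only if the subgroup $\langle x,y\rangle$ is not nilpotent. The degree of a vertex is the number of vertices adjacent to it. *)

(* Defs.v *)
From mathcomp Require Import all_boot all_fingroup all_solvable.

Set Implicit Arguments.
Unset Strict Implicit.
Unset Printing Implicit Defensive.

Local Open Scope group_scope.

Definition degree (T : finType) (V : {set T}) (e : rel T) (x : T) : nat :=
  #|[set y in V | e x y]|.

(* The set of vertex degrees, as a duplicate-free sequence: its cardinality is
   its size. *)
Definition degree_set (T : finType) (V : {set T}) (e : rel T) : seq nat :=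
  undup [seq degree V e x | x in V].

(* Adjacency in the non-nilpotent graph; the subgroup <x, y> does not depend on
   the ambient group, so the vertex set G only enters through the degrees. *)
Definition nonnil_adj (gT : finGroupType) : rel gT :=
  [rel x y | (x != y) && ~~ nilpotent <<[set x; y]>>].

(* Main.v *)
(* Write nil(x) for the set of y in G with <x, y> nilpotent; the degree of x
   is |G| - |nil(x)|, and 1 has degree 0.  Suppose that |nil(x)| takes at most
   one value m other than |G|.  Dividing by the centre preserves this, so assume
   Z(G) = 1.  Let P be a Sylow p-subgroup and 1 != x in Z(P).  If nil(x) = G then
   x centralises P and every p'-element of G, hence G; so |nil(x)| = m < |G|.
   Since P centralises x, |P| divides |nil(x)| = m.  As p varies, |G| divides m,
   a contradiction.

   The divisibility reduces, by splitting y into its p-part and p'-part, to a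
   relative form of Frobenius's theorem: if T <= G and Q is a p-subgroup of
   N_G(T), then |Q| divides the number of u in G with <T, u> a p-group.  When T
   is normal this is Frobenius's theorem on the number of p-elements.  Otherwise
   put N = N_G(T) and let V(K) be the set of u in G \ N with <K, u> a p-group.
   Then the sum of mu(T, K)|V(K)| over T <= K <= N vanishes, and by induction the
   Q-orbit of each K > T contributes a multiple of |Q|. *)
Require Import Defs.
From mathcomp Require Import all_boot all_fingroup all_solvable all_algebra.

Set Implicit Arguments.
Unset Strict Implicit.
Unset Printing Implicit Defensive.

Import GRing.Theory.
Local Open Scope group_scope.

(** * Orbit sums and the Moebius function of the subgroup lattice *)

(** The orbit of [x] contributes [|Q : C_Q[x]| * F x], a multiple of [|Q|]. The values are integers
    because Moebius coefficients can be negative. *)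
Lemma dvdz_sum_orbits (aT : finGroupType) (rT : finType)
    (to : {action aT &-> rT}) (Q : {group aT}) (S : {set rT}) (F : rT -> int) :
  [acts Q, on S | to] ->
  (forall x a, x \in S -> a \in Q -> F (to x a) = F x) ->
  (forall x, x \in S -> (#|'C_Q[x | to]| %| F x)%Z) ->
  (#|Q| %| (\sum_(x in S) F x)%R)%Z.
Proof.
move=> actsS Finv Fdvd.
rewrite (set_partition_big _ (orbit_partition actsS)) /=.
apply: rpred_sum => _ /imsetP[x Sx ->].
rewrite (eq_bigr (fun=> F x)); last first.
  by move=> _ /orbitP[a Qa <-]; apply: Finv.
rewrite sumr_const card_orbit -(Lagrange (subsetIl Q 'C[x | to])).
by rewrite PoszM -mulr_natr natz dvdz_mul ?Fdvd.
Qed.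

(* The Moebius function of the subgroup lattice above [T], by recursion with
   fuel bounding the order of the argument. *)
Fixpoint mobius_rec (gT : finGroupType) (T : {group gT}) (n : nat)
    (L : {group gT}) : int :=
  if n is m.+1 then
    ((L == T)%:R -
     \sum_(K : {group gT} | (T \subset K) && (K \proper L)) mobius_rec T m K)%R
  else 0%R.

Definition mobius (gT : finGroupType) (T L : {group gT}) : int :=
  mobius_rec T #|L| L.

Lemma mobius_recE (gT : finGroupType) (T : {group gT}) n (L : {group gT}) :
  (#|L| <= n)%N -> mobius_rec T n L = mobius T L.
Proof.
rewrite /mobius; elim/ltn_ind: n L => -[|n] IHn L leLn.
  by rewrite leqNgt cardG_gt0 in leLn.
rewrite -(ltn_predK (cardG_gt0 L)) /=; congr (_ - _)%R.
apply: eq_bigr => K /andP[_ /proper_card ltKL].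
have leKn : (#|K| <= n)%N by rewrite -ltnS (leq_trans ltKL).
rewrite IHn // [RHS]IHn //; last by rewrite -ltnS (ltn_predK (cardG_gt0 L)).
by rewrite (leq_trans _ leLn) // (ltn_predK (cardG_gt0 L)).
Qed.

Lemma sum_mobius (gT : finGroupType) (T L : {group gT}) : T \subset L ->
  (\sum_(K : {group gT} | (T \subset K) && (K \subset L)) mobius T K =
    (L == T)%:R)%R.
Proof.
move=> sTL; rewrite (bigD1 L) ?sTL ?subxx //=.
rewrite [X in (_ + X)%R](eq_bigl
  (fun K : {group gT} => (T \subset K) && (K \proper L))); last first.
  by move=> K; rewrite properEneq -andbA [(K \subset L) && _]andbC.
rewrite {1}/mobius -(ltn_predK (cardG_gt0 L)) /=.
under eq_bigr => K /andP[_ ltKL].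
  rewrite mobius_recE; first over.
  by rewrite -ltnS (ltn_predK (cardG_gt0 L)) proper_card.
by rewrite subrK.
Qed.

Lemma mobiusJ (gT : finGroupType) (T L : {group gT}) x :
  x \in 'N(T) -> mobius T (L :^ x)%G = mobius T L.
Proof.
move=> nTx; have TxE : (T :^ x)%G = T by apply/group_inj/normP.
rewrite /mobius cardJg; move: #|L| => n.
elim: n L => //= n IHn L.
congr (_%:R - _)%R.
  by rewrite -{1}TxE (inj_eq (@act_inj _ _ _ 'JG x)).
rewrite (reindex_inj (@act_inj _ _ _ 'JG x)) /=.
apply: eq_big => [K | K _]; last exact: IHn.
by rewrite -{1}TxE /= conjSg properJ.
Qed.

(** Weisner's theorem, by induction on [|L|]: the values of [mobius T] between [T] and [L] sum to 0,
    and so do the blocks [K <*> H = M] with [M] proper in [L], which leaves the block of [L]. *)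
Lemma sum_mobius_join (gT : finGroupType) (T H L : {group gT}) :
    T \proper H ->
  (\sum_(K : {group gT} | (T \subset K) && ((K <*> H)%G == L)) mobius T K
    = 0)%R.
Proof.
move=> /properP[sTH [h Hh notTh]].
elim: {L}_.+1 {-2}L (ltnSn #|L|) => // n IHn L; rewrite ltnS => leLn.
have [sHL | not_sHL] := boolP (H \subset L); last first.
  apply: big_pred0 => K; apply: contraNF not_sHL => /andP[_ /eqP<-].
  exact: joing_subr.
have sTL := subset_trans sTH sHL.
have neqLT : L != T by apply: contraNneq notTh => <-; apply: (subsetP sHL).
have := sum_mobius sTL; rewrite (negPf neqLT).
rewrite (partition_big (fun K : {group gT} => (K <*> H)%G)
  (fun M : {group gT} => M \subset L)) /=; last first.
  by move=> K /andP[_ sKL]; rewrite join_subG sKL.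
rewrite (bigD1 L) //= [X in (_ + X)%R]big1 ?addr0 => [|M /andP[sML neqML]].
  move=> sum0; rewrite -[RHS]sum0; apply: eq_bigl => K; rewrite -andbA; congr (_ && _).
  apply/eqP/andP => [<-|[_ /eqP//]]; split=> //; exact: joing_subl.
rewrite -[RHS](IHn M).
  apply: eq_bigl => K; rewrite -andbA; congr (_ && _).
  apply/andP/eqP => [[_ /eqP//]|defM]; split; last exact/eqP.
  by rewrite (subset_trans _ sML) // -defM joing_subl.
rewrite (leq_trans _ leLn) // proper_card // properEneq sML andbT.
exact: neqML.
Qed.

(** Downward closure makes every fibre of [K |-> K <*> H] over a member of [F] lie wholly in [F], so
    Weisner's theorem kills it. *)
Lemma sum_mobius_family (gT : finGroupType) (T H : {group gT})
    (F : {set {group gT}}) :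
    T \proper H ->
    (forall K L : {group gT},
       T \subset K -> K \subset L -> L \in F -> K \in F) ->
    (forall K : {group gT}, T \subset K -> K \in F -> (K <*> H)%G \in F) ->
  (\sum_(K in F | T \subset K) mobius T K = 0)%R.
Proof.
move=> ltTH downF joinF.
rewrite (partition_big (fun K : {group gT} => (K <*> H)%G) (mem F)) /=; last first.
  by move=> K /andP[FK sTK]; apply: joinF.
rewrite big1 // => L FL; rewrite -[RHS](sum_mobius_join L ltTH).
apply: eq_bigl => K; apply/andP/andP=> [[/andP[_ ->] ->] // | [sTK defL]].
split=> //; rewrite sTK andbT (downF K L) // -(eqP defL); exact: joing_subl.
Qed.

(** * A relative form of Frobenius's theorem *)

Definition pext (p : nat) (gT : finGroupType) (G T : {set gT}) : {set gT} :=
  [set u in G | p.-group (T <*> <[u]>)].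

(** The p-elements of [G] are the solutions of [u ^ |G|_p = 1], which Frobenius's theorem counts. *)
Lemma dvdn_card_p_elt (p : nat) (gT : finGroupType) (G Q : {group gT}) :
  p.-group Q -> Q \subset G -> #|Q| %| #|[set u in G | p.-elt u]|.
Proof.
move=> pQ sQG; apply: (@dvdn_trans #|G|`_p).
  by rewrite -(part_pnat_id pQ) partn_dvd ?cardSg.
suff ->: [set u in G | p.-elt u] = 'Ldiv_(#|G|`_p)(G).
  exact/Frobenius_Ldiv/dvdn_part.
apply/setP=> u; rewrite !inE; apply: andb_id2l => Gu.
rewrite -order_dvdn; apply/idP/idP => [pu | dvd_u].
  by rewrite -(part_pnat_id pu) partn_dvd ?order_dvdG.
exact: pnat_dvd dvd_u (part_pnat _ _).
Qed.

Lemma pextJ (p : nat) (gT : finGroupType) (G T : {set gT}) x :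
  pext p (G :^ x) (T :^ x) = pext p G T :^ x.
Proof.
apply/setP=> u; rewrite mem_conjg !inE mem_conjg; congr (_ && _).
by rewrite -[RHS](pgroupJ _ _ x) /= conjYg -cycleJ conjgKV.
Qed.

Lemma pext_normal (p : nat) (gT : finGroupType) (G T : {group gT}) :
  p.-group T -> T <| G -> pext p G T = [set u in G | p.-elt u].
Proof.
move=> pT /andP[_ nTG]; apply/setP=> u; rewrite !inE; apply: andb_id2l => Gu.
by rewrite norm_joinEr ?cycle_subG ?(subsetP nTG) // pgroupM pT.
Qed.

Lemma mobius_id (gT : finGroupType) (T : {group gT}) : mobius T T = 1%R.
Proof.
have := sum_mobius (subxx T); rewrite eqxx (big_pred1 T) // => K.
by rewrite andbC -eqEsubset.
Qed.

(* If [u] lies outside ['N(T)] then [T] is proper in its normaliser in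
   [<<T, u>>], and joining with that normaliser preserves the family of all
   [K] such that [<<K, u>>] is a p-group. *)
Lemma sum_mobius_pext (p : nat) (gT : finGroupType) (G T : {group gT}) :
  T \subset G ->
  (\sum_(K : {group gT} | (T \subset K) && (K \subset 'N_G(T)))
      mobius T K *+ #|pext p G K :\: 'N_G(T)| = 0)%R.
Proof.
move=> sTG; under eq_bigr do rewrite -sumr_const.
(* After the exchange, the coefficients already cancel for each fixed [u] outside the normaliser. *)
rewrite (exchange_big_dep (mem (G :\: 'N_G(T)))) /=; last first.
  by move=> K u _; rewrite !inE => /andP[-> /andP[->]].
apply: big1 => u /setDP[Gu notNu].
pose F := [set K : {group gT} | (K \subset 'N_G(T)) && p.-group (K <*> <[u]>)].
rewrite (eq_bigl (fun K : {group gT} => (K \in F) && (T \subset K))); last first.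
  move=> K; rewrite in_setD notNu /= !inE Gu /=.
  by rewrite -andbA andbC.
have downF (K L : {group gT}) :
    T \subset K -> K \subset L -> L \in F -> K \in F.
  move=> _ sKL; rewrite !inE => /andP[sLN pL].
  by rewrite (subset_trans sKL) //= (pgroupS _ pL) // genS ?setSU.
have [FT | notFT] := boolP (T \in F); last first.
  apply: big_pred0 => K; apply: contraNF notFT => /andP[FK sTK].
  exact: downF FK.
pose R := (T <*> <[u]>)%G; have pR : p.-group R by move: FT; rewrite inE => /andP[].
have ltTR : T \proper R.
  rewrite properE joing_subl /=; apply: contra notNu => sRT.
  rewrite inE Gu (subsetP (normG T)) // (subsetP sRT) //.
  by rewrite -cycle_subG joing_subr.
apply: (@sum_mobius_family _ T 'N_R(T)%G) => //.
  exact: nilpotent_proper_norm (pgroup_nil pR) ltTR.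
move=> K sTK; rewrite !inE => /andP[sKN pK].
have sRK : R \subset K <*> <[u]> by rewrite genS ?setSU.
rewrite join_subG sKN setSI /=; last first.
  by rewrite join_subG sTG cycle_subG.
by rewrite (pgroupS _ pK) // !join_subG joing_subl joing_subr subIset ?sRK.
Qed.

Lemma dvdn_card_pext (p : nat) (gT : finGroupType) (G T Q : {group gT}) :
    T \subset G -> p.-group Q -> Q \subset 'N_G(T) ->
  #|Q| %| #|pext p G T|.
Proof.
(* This measure drops from [(G, T)] to both [(G, K)] and [(N, K)] when [T < K <= N < G]. *)
have [n] := ubnP (#|G| + #|G| - #|T|).
elim: n G T Q => // n IHn G T Q; rewrite ltnS => leGn sTG pQ sQN.
have [pT | notpT] := boolP (p.-group T); last first.
  suff ->: pext p G T = set0 by rewrite cards0 dvdn0.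
  apply/setP=> u; rewrite !inE; apply/negbTE; apply: contra notpT => /andP[_].
  by apply: pgroupS; apply: joing_subl.
have [nTG | not_nTG] := boolP (T <| G).
  by rewrite pext_normal // dvdn_card_p_elt // (subset_trans sQN) ?subsetIl.
pose N := 'N_G(T)%G; pose V (K : {group gT}) := pext p G K :\: N.
have sTN : T \subset N by rewrite subsetI sTG normG.
have VE (K : {group gT}) : #|pext p G K| = (#|pext p N K| + #|V K|)%N.
  rewrite -(cardsID N (pext p G K)); congr (#|pred_of_set _| + _)%N.
  apply/setP=> u; rewrite !inE.
  by case: (u \in G); rewrite //= andbC.
have ltNG : (#|N| < #|G|)%N.
  rewrite proper_card // properE subsetIl /=; apply: contra not_nTG => sGN.
  by rewrite /normal sTG (subset_trans sGN) ?subsetIr.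
(* Inside [N] the subgroup [T] is normal, so only [V T] is left. *)
rewrite VE dvdn_add //.
  by rewrite pext_normal ?dvdn_card_p_elt // normalSG.
(* The term [K = T] has coefficient 1, so [|V T|] is minus the sum over larger [K]. *)
have := sum_mobius_pext p sTG; rewrite (bigD1 T) ?subxx //= mobius_id.
move/eqP; rewrite addr_eq0 => /eqP Vdef.
suff: (#|Q| %| (1 *+ #|V T|)%R)%Z by rewrite natz.
rewrite Vdef rpredN.
pose S := [set K : {group gT} | [&& T \subset K, K \subset N & K != T]].
rewrite (eq_bigl (fun K => K \in S)) => [|K]; last by rewrite !inE andbA.
have nTQ a : a \in Q -> a \in 'N(T).
  by move=> /(subsetP sQN) /setIP[].
apply: (@dvdz_sum_orbits _ _ 'JG%act) => [|K a|K].
- apply/actsP=> a Qa K; rewrite !inE /=.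
  have NaE : N :^ a = N by apply/normP; rewrite (subsetP (normG N)) ?(subsetP sQN).
  have TaE : (T :^ a)%G = T by apply/group_inj/normP/nTQ.
  rewrite -{1}(normP (nTQ a Qa)) conjSg -{1}NaE conjSg -{2}TaE.
  by rewrite (inj_eq (@act_inj _ _ _ 'JG a)).
- move=> _ Qa /=; rewrite mobiusJ ?nTQ //; congr (_ *+ _)%R.
  have [Ga _] := setIP (subsetP sQN a Qa).
  rewrite -(cardJg (V K) a) /V conjDg -pextJ [G :^ a]conjGid //.
  by rewrite (normP (subsetP (normG N) a (subsetP sQN a Qa))).
rewrite inE astab1JG => /and3P[sTK sKN neqKT].
have ltTK : (#|T| < #|K|)%N.
  by rewrite proper_card // properEneq sTK andbT eq_sym; apply: neqKT.
have [sNG sKG] : N \subset G /\ K \subset G.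
  by rewrite subsetIl (subset_trans sKN) ?subsetIl.
rewrite -mulr_natr natz dvdz_mull //.
(* [|V K|] is the difference of the counts in [G] and in [N], both divisible by [|N_Q(K)|] by
   induction. *)
have: #|'N_Q(K)| %| #|pext p G K|.
  apply: IHn => //.
  - rewrite (leq_trans _ leGn) // ltn_sub2l //.
    by rewrite (leq_trans ltTK) // (leq_trans (subset_leq_card sKG)) ?leq_addr.
  - exact: pgroupS (subsetIl _ _) pQ.
  by rewrite setSI // (subset_trans sQN).
rewrite VE dvdn_addr //; apply: IHn => //.
- rewrite (leq_trans _ leGn) // (leq_ltn_trans (leq_sub2l _ (ltnW ltTK))) //.
  rewrite ltn_sub2r ?addnn ?ltn_double //.
  by rewrite (leq_trans ltTK) // -addnn (leq_trans (subset_leq_card sKG)) ?leq_addr.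
- exact: pgroupS (subsetIl _ _) pQ.
by rewrite setSI // (subset_trans sQN).
Qed.

(** * Nilpotentisers of p-elements *)

Definition nilpotentiser (gT : finGroupType) (G : {set gT}) (x : gT) :=
  [set y in G | nilpotent <<[set x; y]>>].

(** In a nilpotent group elements of coprime orders commute and p-elements lie in the p-core.
    Conversely [<x, y>] lies in a product of two commuting nilpotent groups, [<x, y_p>] and
    [<y_p'>]. *)
Lemma nilpotent_pair_constt (p : nat) (gT : finGroupType) (x y : gT) :
    p.-elt x ->
  nilpotent <<[set x; y]>> =
    (y.`_p^' \in 'C[x]) && p.-group (<[x]> <*> <[y.`_p]>).
Proof.
move=> px; apply/idP/andP => [nilH | [cxv pR]].
  set H := <<_>> in nilH.
  have Hx : x \in H by rewrite mem_gen // !inE eqxx.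
  have sYH : <[y]> \subset H by rewrite cycle_subG mem_gen // !inE eqxx orbT.
  have Hu pi : y.`_pi \in H by rewrite (subsetP sYH) ?cycle_constt.
  split.
    rewrite -cent_cycle -cycle_subG (sub_nilpotent_cent2 nilH) ?cycle_subG //.
    by rewrite (pnat_coprime px) //; apply: p_elt_constt.
  have sOH := mem_normal_Hall (nilpotent_pcore_Hall p nilH) (pcore_normal _ _).
  apply: pgroupS (pcore_pgroup p <<[set x; y]>>).
  by rewrite join_subG !cycle_subG !sOH ?px ?p_elt_constt.
pose R := (<[x]> <*> <[y.`_p]>)%G.
have cRv : <[y.`_p^']> \subset 'C(R).
  rewrite centsC join_subG !cycle_subG /= !cent_cycle [x \in _]cent1C cxv.
  apply/cent1P; apply: (centsP (cycle_abelian y)); exact: cycle_constt.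
apply: (@nilpotentS _ (R <*> <[y.`_p^']>)%G).
  rewrite gen_subG subUset !sub1set -{2}[y](consttC p) groupM //.
  - by rewrite (subsetP (joing_subl _ _)) // (subsetP (joing_subl _ _)) ?cycle_id.
  - by rewrite (subsetP (joing_subl _ _)) // (subsetP (joing_subr _ _)) ?cycle_id.
  - by rewrite (subsetP (joing_subr _ _)) ?cycle_id.
rewrite /= cent_joinEr // mulg_nil // (pgroup_nil pR) /=.
exact: abelian_nil (cycle_abelian _).
Qed.

(** Sort [y] by its p'-part [v]: the fibre is a translate of [pext p 'C_G[v] <[x]>]. Then [Q]
    permutes the [v] by conjugation, and the relative Frobenius theorem applies to the stabiliser
    [C_Q[v]]. *)
Lemma dvdn_card_nilpotentiser (p : nat) (gT : finGroupType) (G Q : {group gT})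
    (x : gT) :
    x \in G -> p.-elt x -> p.-group Q -> Q \subset 'C_G[x] ->
  #|Q| %| #|nilpotentiser G x|.
Proof.
move=> Gx px pQ sQC.
pose S := [set v in 'C_G[x] | p^'.-elt v].
have fibE v : v \in S ->
  [set y in nilpotentiser G x | y.`_p^' == v] = pext p 'C_G[v] <[x]> :* v.
  case/setIdP=> /setIP[Gv cxv] p'v; apply/setP=> y; rewrite mem_rcoset.
  apply/setIdP/setIdP=> [[/setIdP[Gy]] | [/setIP[Guv cuv] pR]].
    rewrite (nilpotent_pair_constt y px) => /andP[_ pR] /eqP defv.
    have -> : y * v^-1 = y.`_p by rewrite -{1}[y](consttC p) defv mulgK.
    rewrite in_setI pR groupX //; split=> //; apply/cent1P; rewrite -defv.
    by apply: (centsP (cycle_abelian y)); apply: cycle_constt.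
  have pu : p.-elt (y * v^-1).
    by apply: pgroupS pR; apply: joing_subr.
  have defu : y.`_p = y * v^-1.
    rewrite -{1}[y](mulgKV v) consttM; last exact/cent1P/cuv.
    by rewrite constt_p_elt // (constt1P p'v) mulg1.
  have defv : y.`_p^' = v.
    by apply: (mulgI y.`_p); rewrite consttC defu mulgKV.
  split; last exact/eqP; apply/setIdP; split.
    by rewrite -(groupMr _ (groupVr Gv)).
  by rewrite (nilpotent_pair_constt y px) defu defv cxv.
have -> : #|nilpotentiser G x| = \sum_(v in S) #|pext p 'C_G[v] <[x]>|.
  rewrite -sum1_card (partition_big (fun y => y.`_p^') (mem S)) /=; last first.
    move=> y /setIdP[Gy]; rewrite (nilpotent_pair_constt y px) => /andP[cxv _].
    by apply/setIdP; rewrite in_setI groupX // cxv p_elt_constt.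
  apply: eq_bigr => v Sv; rewrite -(card_rcoset _ v) -fibE // -sum1_card.
  by apply: eq_bigl => y; rewrite [RHS]in_set.
suff: (#|Q| %| (\sum_(v in S) #|pext p 'C_G[v] <[x]>|%:Z)%R)%Z.
  by rewrite -(big_morph Posz PoszD (erefl (Posz 0))) dvdzE.
apply: (@dvdz_sum_orbits _ _ 'J%act) => [|v a|v].
- apply/actsP=> a /(subsetP sQC) Ca v.
  rewrite [LHS]in_set [RHS]in_set p_eltJ; congr (_ && _).
  by rewrite memJ_norm // (subsetP (normG _)).
- move=> _ Qa /=; have /setIP[Ga cxa] := subsetP sQC a Qa.
  rewrite -(cardJg (pext p 'C_G[v] <[x]>) a) -pextJ conjIg conjGid //.
  have xaE : x ^ a = x by apply/conjg_fixP/commgP/cent1P; rewrite cent1C.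
  by rewrite -normJ conjg_set1 -cycleJ xaE.
case/setIdP=> /setIP[Gv cxv] p'v; rewrite astab1J.
rewrite dvdzE /=; apply: dvdn_card_pext.
- by rewrite cycle_subG in_setI Gx cent1C.
- exact: pgroupS (subsetIl _ _) pQ.
apply/subsetP=> a /setIP[/(subsetP sQC)/setIP[Ga cxa] cva].
rewrite !in_setI Ga cva /=.
by rewrite (subsetP (cent_sub _)) // cent_cycle.
Qed.

(** * Passage to the central quotient *)

(** [K = <x, y> Z(G)] is a central extension of the image of [<x, y>], so it is nilpotent when that
    image is. *)
Lemma nilpotent_pair_quotient (gT : finGroupType) (G : {group gT}) (x y : gT) :
    x \in G -> y \in G ->
  nilpotent <<[set coset 'Z(G) x; coset 'Z(G) y]>> = nilpotent <<[set x; y]>>.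
Proof.
move=> Gx Gy; set Z := 'Z(G).
have nZG : G \subset 'N(Z) := normal_norm (center_normal G).
have sHG : <<[set x; y]>> \subset G.
  by rewrite gen_subG subUset !sub1set Gx.
have -> : <<[set coset Z x; coset Z y]>> = <<[set x; y]>> / Z.
  rewrite quotient_gen; last by rewrite subUset !sub1set !(subsetP nZG).
  by rewrite quotientU !quotient_set1 ?(subsetP nZG).
apply/idP/idP => [nilHZ|]; last exact: quotient_nil.
pose K := (<<[set x; y]>> <*> Z)%G.
have sKG : K \subset G by rewrite join_subG sHG center_sub.
have sZK : Z \subset 'Z(K).
  by rewrite subsetI joing_subr (subset_trans (subsetIr _ _)) ?centS.
apply: (@nilpotentS _ K); first exact: joing_subl.
have nsZK : Z <| K by rewrite /normal joing_subr (subset_trans sKG).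
rewrite -quotient_center_nil -(isog_nil (third_isog sZK nsZK (center_normal K))).
by rewrite quotient_nil //= quotientYidr // (subset_trans sHG).
Qed.

Lemma card_nilpotentiser_quotient (gT : finGroupType) (G : {group gT}) x :
    x \in G ->
  #|nilpotentiser G x| =
    (#|nilpotentiser (G / 'Z(G)) (coset 'Z(G) x)| * #|'Z(G)|)%N.
Proof.
move=> Gx; have nZG : G \subset 'N('Z(G)) := normal_norm (center_normal G).
rewrite -sum1_card (partition_big (coset 'Z(G))
  (mem (nilpotentiser (G / 'Z(G)) (coset 'Z(G) x)))) /=; last first.
  by move=> y; rewrite !inE => /andP[Gy]; rewrite nilpotent_pair_quotient ?mem_quotient.
rewrite -sum_nat_const; apply: eq_bigr => yb.
rewrite inE => /andP[/morphimP[y Ny Gy ->{yb}]].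
rewrite nilpotent_pair_quotient // => nily.
rewrite sum1_card -(card_rcoset 'Z(G) y); apply: eq_card => z.
rewrite [LHS]inE /= inE.
apply/andP/idP=> [[/andP[Gz _] /eqP eqzy] | yZz].
  by apply/rcoset_kercosetP; rewrite ?(subsetP nZG).
have Gz : z \in G by case/rcosetP: yZz => c /(subsetP (center_sub G)) Gc ->; rewrite groupM.
have eqzy : coset 'Z(G) z = coset 'Z(G) y.
  by apply/rcoset_kercosetP; rewrite ?(subsetP nZG).
by rewrite Gz eqzy -(nilpotent_pair_quotient Gx Gz) eqzy nilpotent_pair_quotient.
Qed.

(** * Nilpotency from the sizes of nilpotentisers *)

(** [C_G[x]] contains a Sylow subgroup for every prime: [P] itself for p, and for [q != p] any Sylow
    q-subgroup, whose elements are their own p'-parts. *)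
Lemma center_of_full_nilpotentiser (p : nat) (gT : finGroupType)
    (G P : {group gT}) (x : gT) :
    p.-Sylow(G) P -> x \in 'Z(P) -> nilpotentiser G x = G -> x \in 'Z(G).
Proof.
move=> sylP /setIP[Px cPx] fullx.
have Gx := subsetP (pHall_sub sylP) x Px.
have px := mem_p_elt (pHall_pgroup sylP) Px.
suff sGC : G \subset 'C_G[x].
  by rewrite inE Gx -sub_cent1 (subset_trans sGC) ?subsetIr.
suff dvdGC : #|G| %| #|'C_G[x]|.
  have /eqP eqCG : 'C_G[x] == G by rewrite eqEcard subsetIl dvdn_leq.
  by rewrite eqCG.
apply/(dvdn_partP _ (cardG_gt0 G)) => q _.
have [Q sylQ] := Sylow_exists q G.
have [eqpq | neqpq] := eqVneq q p.
  rewrite eqpq -(card_Hall sylP) cardSg // subsetI (pHall_sub sylP).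
  by rewrite sub_cent1.
rewrite -(card_Hall sylQ) cardSg // subsetI (pHall_sub sylQ).
apply/subsetP=> y Qy; have: y \in nilpotentiser G x.
  by rewrite fullx (subsetP (pHall_sub sylQ)).
rewrite inE (nilpotent_pair_constt y px) => /and3P[_ cxy _].
rewrite constt_p_elt // in cxy.
apply: sub_in_pnat (mem_p_elt (pHall_pgroup sylQ) Qy) => r _.
by rewrite !inE => /eqP->.
Qed.

Lemma nilpotent_two_nilpotentiser_cards (gT : finGroupType) (G : {group gT})
    (m : nat) :
    (forall x, x \in G ->
       #|nilpotentiser G x| = #|G| \/ #|nilpotentiser G x| = m) ->
  nilpotent G.
Proof.
have [n] := ubnP #|G|; elim: n gT G m => // n IHn gT G m; rewrite ltnS => leGn cardG.
have [Z1 | ntZ] := eqVneq 'Z(G) 1; last first.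
  (* Both [|G|] and the nilpotentiser sizes get divided by [|Z(G)|]. *)
  rewrite -quotient_center_nil; apply: (IHn _ _ (m %/ #|'Z(G)|)%N).
    by rewrite (leq_trans _ leGn) // ltn_quotient ?center_sub.
  move=> _ /morphimP[x _ Gx ->].
  have := cardG x Gx; rewrite card_nilpotentiser_quotient //.
  rewrite card_quotient ?normal_norm ?center_normal // -divgS ?center_sub //.
  by case=> <-; [left | right]; rewrite mulnK ?cardG_gt0.
have [-> | ntG] := eqVneq G 1%G; first exact: nilpotent1.
have key p : p \in \pi(G) -> #|G|`_p %| m /\ (0 < m < #|G|)%N.
  move=> piGp; have [P sylP] := Sylow_exists p G.
  have ntP : P :!=: 1.
    by rewrite -cardG_gt1 (card_Hall sylP) p_part_gt1.
  have [x Zx ntx] : exists2 x, x \in 'Z(P) & x != 1.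
    apply/trivgPn; apply: contra ntP => /eqP.
    by move/(trivg_center_pgroup (pHall_pgroup sylP)) ->.
  have [Px cPx] := setIP Zx.
  have Gx := subsetP (pHall_sub sylP) x Px.
  have ltm : (#|nilpotentiser G x| < #|G|)%N.
    rewrite proper_card // properE; apply/andP; split.
      by apply/subsetP=> y /setIdP[].
    apply: contra ntx => sGN; apply/eqP/set1gP; rewrite -Z1.
    apply: (center_of_full_nilpotentiser sylP Zx).
    by apply/eqP; rewrite eqEsubset sGN andbT; apply/subsetP=> y /setIdP[].
  have defm : #|nilpotentiser G x| = m.
    by case: (cardG x Gx) => // eqG; rewrite eqG ltnn in ltm.
  rewrite -defm ltm andbT -(card_Hall sylP); split.
    apply: (dvdn_card_nilpotentiser (p := p)) => //.
    - exact: mem_p_elt (pHall_pgroup sylP) Px.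
    - exact: pHall_pgroup sylP.
    by rewrite subsetI (pHall_sub sylP) sub_cent1.
  apply/card_gt0P; exists x; rewrite inE Gx setUid.
  exact: abelian_nil (cycle_abelian x).
(* Any prime divisor of [|G|] yields the bounds on [m]. *)
have /key[_ /andP[m_gt0 ltmG]] : pdiv #|G| \in \pi(G).
  by rewrite pi_pdiv cardG_gt1.
have: #|G| %| m by apply/(dvdn_partP _ (cardG_gt0 G)) => p /key[].
by move/(dvdn_leq m_gt0); rewrite leqNgt ltmG.
Qed.

(** * Vertex degrees *)

Lemma degree_nonnil_adj (gT : finGroupType) (G : {group gT}) x :
  degree G (@nonnil_adj gT) x = (#|G| - #|nilpotentiser G x|)%N.
Proof.
have sNG : nilpotentiser G x \subset G by apply/subsetP=> y /setIdP[].
rewrite -(setIidPr sNG) -cardsD; apply: eq_card => y.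
rewrite !inE /=; case: (y \in G) => //=; rewrite andbT.
rewrite /nonnil_adj /=; case: eqP => //= <-; rewrite setUid.
by rewrite (abelian_nil (cycle_abelian x)).
Qed.

Theorem theorem7p1 (gT : finGroupType) (G : {group gT}) :
  nilpotent G <-> (size (degree_set G (@nonnil_adj gT)) <= 2)%N.
Proof.
pose d := degree G (@nonnil_adj gT).
have d_in x : x \in G -> d x \in degree_set G (@nonnil_adj gT).
  by move=> Gx; rewrite mem_undup; apply/imageP; exists x.
split=> [nilG | le2].
  apply: (@leq_trans (size [:: 0])) => //; apply: uniq_leq_size (undup_uniq _) _.
  move=> _ /[!mem_undup] /imageP[x Gx ->]; rewrite inE degree_nonnil_adj subn_eq0.
  apply/subset_leq_card/subsetP=> y Gy; rewrite inE Gy.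
  by apply: nilpotentS nilG; rewrite gen_subG subUset !sub1set Gx.
have d1 : d 1 = 0.
  apply/eqP; rewrite /d degree_nonnil_adj subn_eq0.
  apply/subset_leq_card/subsetP=> y Gy; rewrite inE Gy.
  apply: nilpotentS (abelian_nil (cycle_abelian y)).
  by rewrite gen_subG subUset !sub1set group1 cycle_id.
have [k dk] : exists k, forall x, x \in G -> d x = 0 \/ d x = k.
  have [/exists_inP[x Gx dx] | /exists_inPn dG0] :=
    boolP [exists x in G, d x != 0]; last first.
    (* If all degrees vanish, any [k] would do; 0 is taken. *)
    by exists 0 => x Gx; left; apply/eqP; have := dG0 x Gx; rewrite negbK.
  exists (d x) => y Gy; have [-> | dy] := eqVneq (d y) 0; [by left | right].
  apply: contraTeq le2 => neqd; rewrite -ltnNge.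
  (* Otherwise 0, the degree of [1], would be one of three distinct degrees. *)
  apply: (@leq_trans (size [:: 0; d x; d y])) => //.
  apply: uniq_leq_size => [|e].
    by rewrite /= !inE negb_or ![0 == _]eq_sym dx dy eq_sym neqd.
  by rewrite !inE => /or3P[] /eqP->; rewrite -?d1 d_in.
apply: (@nilpotent_two_nilpotentiser_cards _ G (#|G| - k)) => x Gx.
have leN : (#|nilpotentiser G x| <= #|G|)%N.
  by apply/subset_leq_card/subsetP=> y /setIdP[].
rewrite -(subKn leN) -degree_nonnil_adj -/d.
by case: (dk x Gx) => ->; [left; rewrite subn0 | right].
Qed.
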